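(* Let $n\geq 1$ and let $A\subseteq\{0,1\}^n$ be a nonempty monotone set. Then the mixing time of the censored chain $M_A$ on $A$ satisfies $$\tau_{\mathrm{mix}}(M_A)\;\leq\; 2\left(\frac{16\,n}{\mathbb{P}[A]}\right)^2\log\bigl(4\cdot 2^n\,\mathbb{P}[A]\bigr),$$ where $\mathbb{P}$ is the uniform probability measure on $\{0,1\}^n$.
   Context: Partial order: for $x,y\in\{0,1\}^n$, $x\leq y$ means $x_i\leq y_i$ for all $i\in\{1,\dots,n\}$. A set $A\subseteq\{0,1\}^n$ is monotone if $x\in A$ and $x\leq y$ imply $y\in A$. $\mathbb{P}$ denotes the uniform probability measure on $\{0,1\}^n$, so $\mathbb{P}[A]=|A|/2^n$. The chain $M_A$ is the Markov chain with state space $A$ and the following transition rule: given the current state $x\in A$, pick a coordinate $i\in\{1,\dots,n\}$ uniformly at random and re-randomize $x_i$ (replace it by a uniform random element of $\{0,1\}$, independently of everything else), obtaining $y\in\{0,1\}^n$; the next state is $y$ if $y\in A$, and $x$ otherwise. The chain is irreducible and aperiodic, and its stationary distribution is the uniform distribution $\pi_A$ on $A$. The mixing time is the standard one (worst case over starting states, total variation threshold $1/4$): $$\tau_{\mathrm{mix}}(M_A)=\min\Bigl\{t\in\mathbb{Z}_{\geq 0}:\ \max_{x_0\in A}\bigl\|P_A^t(x_0,\cdot)-\pi_A\bigr\|_{TV}\leq \tfrac14\Bigr\},$$ where $P_A$ is the transition matrix of $M_A$ and $\|\mu-\nu\|_{TV}=\frac12\sum_{x\in A}|\mu(x)-\nu(x)|$.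 The logarithm is natural. *)

(* Defs.v *)
From HB Require Import structures.
From mathcomp Require Import all_boot all_order all_algebra.
From mathcomp Require Import reals exp.

Set Implicit Arguments.
Unset Strict Implicit.
Unset Printing Implicit Defensive.

Import Order.TTheory GRing.Theory Num.Theory.
Local Open Scope ring_scope.

Definition cube (n : nat) := {ffun 'I_n -> bool}.

Definition cube_le (n : nat) (x y : cube n) : Prop :=
  forall i : 'I_n, (x i <= y i)%N.

Definition monotone_set (n : nat) (A : {set cube n}) : Prop :=
  forall x y : cube n, x \in A -> cube_le x y -> y \in A.

Definition unif_prob (R : realType) (n : nat) (A : {set cube n}) : R :=
  #|A|%:R / 2%:R ^+ n.

Definition set_coord (n : nat) (x : cube n) (i : 'I_n) (b : bool) : cube n :=
  [ffun j => if j == i then b else x j].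

Definition censored_move (n : nat) (A : {set cube n}) (x : cube n)
    (i : 'I_n) (b : bool) : cube n :=
  let y := set_coord x i b in if y \in A then y else x.

(* The pair (i, b) is uniform on 'I_n * bool. *)
Definition step_prob (R : realType) (n : nat) (A : {set cube n})
    (x y : cube n) : R :=
  \sum_(i < n) \sum_(b : bool)
    n%:R^-1 * 2%:R^-1 * (censored_move A x i b == y)%:R.

(* The states are the elements of A, enumerated by enum_val : 'I_#|A| -> cube n;
   entry (i, j) is the probability of moving from state i to state j. *)
Definition trans_mx (R : realType) (n : nat) (A : {set cube n}) : 'M[R]_#|A| :=
  \matrix_(i, j) step_prob R A (enum_val i) (enum_val j).

Definition unif_dist (R : realType) (n : nat) (A : {set cube n}) :
    'rV[R]_#|A| :=
  \row_j #|A|%:R^-1.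

Definition tv_dist (R : realType) (m : nat) (mu nu : 'rV[R]_m) : R :=
  2%:R^-1 * \sum_(j < m) `|mu 0 j - nu 0 j|.

(* The default value 0 of the maximum is harmless, since distances are
   nonnegative. *)
Definition worst_tv (R : realType) (n : nat) (A : {set cube n}) (t : nat) : R :=
  \big[Num.max/0]_(i < #|A|) tv_dist (row i (trans_mx R A ^+ t)) (unif_dist R A).

(* [is_mixing_time R A tau]: tau is the minimum of the set of times t with
   worst_tv R A t <= 1/4; in particular that set is nonempty. *)
Definition is_mixing_time (R : realType) (n : nat) (A : {set cube n})
    (tau : nat) : Prop :=
  worst_tv R A tau <= 4%:R^-1 /\
  forall t : nat, worst_tv R A t <= 4%:R^-1 -> (tau <= t)%N.

(* Main.v *)
(* Let e(S, T) be the number of edges between S and T = A \ S. Induction on the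
   dimension gives |S| |T| <= 2^n e(S, T), so sets S with 2 |S| <= |A| have
   expansion of order P[A]; Cheeger's argument turns this into a Poincare
   inequality. Each censored coordinate update averages f with its composite with
   an involution of A, hence is an orthogonal projection of L2(A), and so one step
   of the chain contracts the squared L2 distance to uniform by the factor
   1 - P[A]^2 / (64 n^2). *)
Require Import Defs.
From mathcomp Require Import all_boot all_order all_algebra.
From mathcomp Require Import reals sequences exp.
From mathcomp Require Import zify ring lra.
Import Order.TTheory GRing.Theory Num.Theory.
Local Open Scope ring_scope.

(** * Edge isoperimetry for up-closed subsets of the cube *)

Section Isoperimetry.
Set Implicit Arguments.
Local Open Scope nat_scope.

Definition flip (n : nat) (x : cube n) (i : 'I_n) : cube n :=
  set_coord x i (~~ x i).

Definition cons_cube (n : nat) (b : bool) (x : cube n) : cube n.+1 :=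
  [ffun i => if unlift ord0 i is Some j then x j else b].

Lemma cons_cube0 n b (x : cube n) : cons_cube b x ord0 = b.
Proof. by rewrite ffunE unlift_none. Qed.

Lemma cons_cubeS n b (x : cube n) j : cons_cube b x (lift ord0 j) = x j.
Proof. by rewrite ffunE liftK. Qed.

Lemma flip_cons_cube0 n b (x : cube n) :
  flip (cons_cube b x) ord0 = cons_cube (~~ b) x.
Proof.
apply/ffunP => i; rewrite ffunE; case: (unliftP ord0 i) => [j ->|->].
  by rewrite eq_sym (negbTE (neq_lift _ _)) !cons_cubeS.
by rewrite eqxx !cons_cube0.
Qed.

Lemma flip_cons_cubeS n b (x : cube n) i :
  flip (cons_cube b x) (lift ord0 i) = cons_cube b (flip x i).
Proof.
apply/ffunP => j; rewrite ffunE; case: (unliftP ord0 j) => [k ->|->].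
  by rewrite (inj_eq lift_inj) !cons_cubeS ffunE.
by rewrite (negbTE (neq_lift _ _)) !cons_cube0.
Qed.

Lemma cube_le_cons n (b c : bool) (x y : cube n) :
  b <= c -> cube_le x y -> cube_le (cons_cube b x) (cons_cube c y).
Proof.
move=> bc xy i; case: (unliftP ord0 i) => [j ->|->].
  by rewrite !cons_cubeS.
by rewrite !cons_cube0.
Qed.

Lemma sum_cubeS n (F : cube n.+1 -> nat) :
  \sum_x F x =
  \sum_(x : cube n) F (cons_cube false x) +
  \sum_(x : cube n) F (cons_cube true x).
Proof.
rewrite (reindex (fun p : bool * cube n => cons_cube p.1 p.2)) /=.
  rewrite -(pair_bigA _ (fun b x => F (cons_cube b x))) /=.
  by rewrite big_bool /= addnC.
exists (fun y : cube n.+1 => (y ord0, [ffun j => y (lift ord0 j)])) => [[b x] _|y _] /=.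
  rewrite cons_cube0; congr pair; apply/ffunP => j.
  by rewrite ffunE cons_cubeS.
apply/ffunP => i; case: (unliftP ord0 i) => [j ->|->].
  by rewrite cons_cubeS ffunE.
by rewrite cons_cube0.
Qed.

(* Split the cube along one coordinate into halves S0, S1 and T0, T1. The sum of
   the two inductive bounds falls short by at most (s0 - s1)(t1 - t0), which
   only matters when the factors have the same sign. Then S0, whose upward
   shift lies in the union of S1 and T1, has at least s0 - s1 edges to T1 (and
   symmetrically for T0). *)
Lemma edge_isoperimetry n (S T : pred (cube n)) :
    (forall x, ~~ (S x && T x)) ->
    (forall x y, S x || T x -> cube_le x y -> S y || T y) ->
  (\sum_x S x) * (\sum_x T x) <= 2 ^ n * \sum_x \sum_i (S x && T (flip x i)).
Proof.
elim: n S T => [|n IH] S T disj up.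
  have u (x y : cube 0) : x = y by apply/ffunP => -[].
  pose x0 : cube 0 := [ffun => false].
  have sum0 F : \sum_(x : cube 0) F x = F x0.
    by rewrite (bigD1 x0) //= big1 ?addn0 // => y; rewrite (u y x0) eqxx.
  by rewrite !sum0; move: (disj x0); case: (S x0); case: (T x0).
pose h b (x : cube n) := cons_cube b x.
have IHb b : (\sum_x S (h b x)) * (\sum_x T (h b x)) <=
    2 ^ n * \sum_x \sum_i (S (h b x) && T (h b (flip x i))).
  apply: (IH (fun x => S (h b x)) (fun x => T (h b x))) => [x|x y Sx xy].
    exact: disj.
  by apply: (up _ _ Sx); apply: cube_le_cons.
have up01 x : S (h false x) || T (h false x) -> S (h true x) || T (h true x).
  by move=> Sx; apply: (up _ _ Sx); apply: cube_le_cons.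
have le1 (P : pred (cube n)) : \sum_x P x <= 2 ^ n.
  apply: (@leq_trans (\sum_(x : cube n) 1)).
    by apply: leq_sum => x _; case: (P x).
  by rewrite sum1_card card_ffun card_bool card_ord.
have cS : \sum_x S (h false x) <=
    \sum_x S (h true x) + \sum_x (S (h false x) && T (h true x)).
  rewrite -big_split; apply: leq_sum => x _ /=.
  by case: (S (h false x)) (T (h false x)) (S (h true x)) (T (h true x)) (up01 x)
    => -[] -[] -[] //= /(_ isT).
have cT : \sum_x T (h false x) <=
    \sum_x T (h true x) + \sum_x (S (h true x) && T (h false x)).
  rewrite -big_split; apply: leq_sum => x _ /=.
  by case: (S (h false x)) (T (h false x)) (S (h true x)) (T (h true x)) (up01 x)
    => -[] -[] -[] //= /(_ isT).
rewrite !sum_cubeS.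
(* An edge leaving [S] in the half [b] runs either along the split coordinate or inside that
   half. *)
have E b : \sum_x \sum_i (S (h b x) && T (flip (h b x) i)) =
  \sum_x (S (h b x) && T (h (~~ b) x)) +
  \sum_x \sum_i (S (h b x) && T (h b (flip x i))).
  rewrite -big_split; apply: eq_bigr => x _ /=.
  rewrite big_ord_recl flip_cons_cube0; congr addn.
  by apply: eq_bigr => i _; rewrite flip_cons_cubeS.
rewrite !E /=.
have := IHb false; have := IHb true.
have := le1 (fun x => S (h true x)); have := le1 (fun x => T (h true x)).
have := le1 (fun x => S (h false x)); have := le1 (fun x => T (h false x)).
move: cS cT; rewrite expnS /h.
set s0 := \sum_x S _; set s1 := \sum_x S _.
set t0 := \sum_x T _; set t1 := \sum_x T _.
set c01 := \sum_x _; set c10 := \sum_x _.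
set e0 := \sum_x _; set e1 := \sum_x _.
move: s0 s1 t0 t1 c01 c10 e0 e1 (2 ^ n) => {IH disj up IHb up01 le1 E}.
move=> s0 s1 t0 t1 c01 c10 e0 e1 N sc tc t0N s0N t1N s1N st1 st0.
(* After the factor 2 in [2 ^ n.+1] doubles the inductive bounds, only these cross terms remain to
   be paid for. Their excess over the diagonal terms is (s0 - s1)(t1 - t0). *)
have : s0 * t1 + s1 * t0 <= s0 * t0 + s1 * t1 + N * (c01 + c10).
  have [s01|/ltnW s10] := leqP s0 s1; have [t01|/ltnW t10] := leqP t0 t1.
  - by have := leq_mul (leq_subr s0 s1) (leq_subr t0 t1); nia.
  - have : (s1 - s0) * (t0 - t1) <= N * c10 by apply: leq_mul; lia.
    nia.
  - have : (s0 - s1) * (t1 - t0) <= c01 * N by apply: leq_mul; lia.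
    nia.
  - nia.
nia.
Qed.

End Isoperimetry.

Section CensoredWalk.
Set Implicit Arguments.
Unset Strict Implicit.
Variables (R : realType) (n : nat) (A : {set cube n}).

(** * Censored flips and transition probabilities *)

Lemma flipK (x : cube n) i : flip (flip x i) i = x.
Proof.
by apply/ffunP => j; rewrite !ffunE eqxx; case: eqP => [->|//]; rewrite negbK.
Qed.

(** A rejected flip becomes a fixed point, which makes this an involution of [A]. *)
Definition cflip (i : 'I_n) (x : cube n) : cube n :=
  if flip x i \in A then flip x i else x.

Lemma cflip_in i x : x \in A -> cflip i x \in A.
Proof. by rewrite /cflip; case: ifP. Qed.

Lemma cflipK i x : x \in A -> cflip i (cflip i x) = x.
Proof.
rewrite /cflip => xA; case: (boolP (flip x i \in A)) => [_|/negbTE ->//].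
by rewrite flipK xA.
Qed.

Lemma sum_cflip i (F : cube n -> R) :
  \sum_(x in A) F (cflip i x) = \sum_(x in A) F x.
Proof.
rewrite [RHS](reindex_onto (cflip i) (cflip i)) => [|x]; last exact: cflipK.
apply: eq_bigl => x; case: (boolP (x \in A)) => [xA|xA].
  by rewrite cflip_in // cflipK // eqxx.
(* A point outside [A] whose flip lies in [A] is not recovered by a second [cflip], because the flip
   back is censored. *)
rewrite /cflip; case: (boolP (flip x i \in A)) => [fA|_]; last by rewrite (negbTE xA).
by rewrite flipK (negbTE xA) fA; apply/esym/eqP => E; rewrite -E fA in xA.
Qed.

(** Of the two values of the new bit, one equals [x i] and leaves [x] in place, the other performs
    the censored flip. *)
Lemma step_probE x y : x \in A ->
  step_prob R A x y =
  n%:R^-1 * \sum_i 2%:R^-1 * ((x == y)%:R + (cflip i x == y)%:R).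
Proof.
move=> xA; rewrite mulr_sumr; apply: eq_bigr => i _.
have E : censored_move A x i (x i) = x.
  have xE : set_coord x i (x i) = x.
    by apply/ffunP => j; rewrite ffunE; case: eqP => [->|].
  by rewrite /censored_move xE xA.
rewrite (bigD1 (x i)) //= (bigD1 (~~ x i)) /=; last by case: (x i).
rewrite big1 ?addr0 => [|b]; last by case: (x i); case: b.
by rewrite E -[censored_move _ _ _ _]/(cflip i x) !mulrA -mulrDr.
Qed.

(** * Isoperimetric inequalities in a monotone set *)

Let p : R := unif_prob R A.

Hypothesis Amon : monotone_set A.

(** The complement of [S] in [A] has at least |A| / 2 points, so |S| |A \ S| <= 2^n e gives e >= (p
    / 2) |S|. The right-hand side sees each edge from both ends; those seen from [S] already
    suffice. *)
Lemma edge_isoperimetry_half (S : {set cube n}) :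
    S \subset A -> (2 * #|S| <= #|A|)%N ->
  p / 2%:R * #|S|%:R <=
  \sum_(x in A) \sum_i `|(x \in S)%:R - (cflip i x \in S)%:R : R|.
Proof.
move=> /subsetP SA S2.
have UA x : (x \in S) || (x \in A :\: S) = (x \in A).
  by rewrite inE; case: (boolP (x \in S)) => [/SA ->|].
have disj x : ~~ ((x \in S) && (x \in A :\: S)).
  by rewrite inE; case: (x \in S).
have up x y : (x \in S) || (x \in A :\: S) -> cube_le x y ->
    (y \in S) || (y \in A :\: S).
  by rewrite !UA => xA xy; apply: Amon xy.
have := @edge_isoperimetry _ [pred x | x \in S] [pred x | x \in A :\: S] disj up.
have card_sum (B : {set cube n}) : (\sum_x (x \in B))%N = #|B|.
  by rewrite -sum1_card [RHS]big_mkcond; apply: eq_bigr => x _; case: (x \in B).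
rewrite !card_sum cardsD (setIidPr _); last exact/subsetP.
set e := (\sum_x _)%N => He.
apply: (@le_trans _ _ e%:R).
  have : (#|A| * #|S| <= 2 * 2 ^ n * e)%N by nia.
  rewrite -(ler_nat R) !natrM natrX /p /unif_prob => H.
  rewrite -(@ler_pM2l _ (2%:R * 2%:R ^+ n)); last by rewrite mulr_gt0 ?exprn_gt0.
  apply: le_trans H; rewrite le_eqVlt; apply/orP; left; apply/eqP.
  by field; rewrite expf_neq0 ?pnatr_eq0.
rewrite /e natr_sum [leRHS]big_mkcond; apply: ler_sum => x _ /=.
case: (boolP (x \in A)) => xA; last first.
  rewrite big1 // => i _; case: (boolP (x \in S)) => // /SA.
  by rewrite (negbTE xA).
rewrite natr_sum; apply: ler_sum => i _.
case: (boolP (x \in S)) => xS; last by rewrite normr_ge0.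
rewrite inE /= /cflip.
case: (boolP (flip x i \in A)) => /= [_|_]; last by rewrite andbF normr_ge0.
by rewrite andbT; case: (_ \in S); rewrite ?subr0 ?normr1 ?normr_ge0.
Qed.

(** Discrete co-area argument: peel off the layer of height [c], the least positive value of [g],
    over the support [S]. Both sides are additive under this splitting, the set inequality handles
    the layer, and the rest has a smaller support because it vanishes at the minimizer [z]. *)
Lemma L1_isoperimetry (g : cube n -> R) :
    (forall x, x \in A -> 0 <= g x) ->
    (2 * #|[set x in A | (0 < g x)%R]| <= #|A|)%N ->
  p / 2%:R * \sum_(x in A) g x <=
  \sum_(x in A) \sum_i `|g x - g (cflip i x)|.
Proof.
have [m] := ubnP #|[set x in A | 0 < g x]|.
elim: m g => // m IH g; set S := [set x in A | _] => Sm g0 S2.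
have SP x : x \in A -> (x \in S) = (0 < g x) by rewrite inE => ->.
have gS x : x \in A -> x \notin S -> g x = 0.
  move=> xA; rewrite SP // -leNgt => gx.
  by apply/eqP; rewrite eq_le gx g0.
have [S0|[x0 x0S]] := set_0Vmem S.
  rewrite big1 ?mulr0 => [|x xA]; last by rewrite gS // S0 inE.
  by apply: sumr_ge0 => x _; apply: sumr_ge0.
case: (@arg_minP _ _ _ x0 (fun x => x \in S) g x0S) => z zS zmin.
set c := g z; pose h x : R := (x \in S)%:R.
have c0 : 0 < c by move: zS; rewrite inE => /andP[].
pose g2 x := g x - c * h x.
have g2_ge0 x : x \in A -> 0 <= g2 x.
  move=> xA; rewrite /g2 /h; case: (boolP (x \in S)) => xS.
    by rewrite mulr1 subr_ge0 zmin.
  by rewrite mulr0 subr0 g0.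
have supp : [set x in A | 0 < g2 x] \subset S :\ z.
  apply/subsetP => x; rewrite !inE => /andP[xA]; rewrite xA /= => gx.
  have xS : x \in S.
    by apply: contraLR gx => xS; rewrite /g2 /h (negbTE xS) gS // mulr0 subrr ltxx.
  rewrite -SP // xS andbT; apply: contraTneq gx => ->.
  by rewrite /g2 /h zS mulr1 subrr ltxx.
have cardS : #|S| = #|S :\ z|.+1 by rewrite (cardsD1 z) zS.
have lec := subset_leq_card supp.
have H2 := IH g2 ltac:(lia) g2_ge0 ltac:(lia).
have H1 : p / 2%:R * \sum_(x in A) h x <=
    \sum_(x in A) \sum_i `|h x - h (cflip i x)|.
  apply: le_trans (edge_isoperimetry_half _ S2); last first.
    by apply/subsetP => x; rewrite inE => /andP[].
  rewrite le_eqVlt; apply/orP; left; apply/eqP; congr (_ * _).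
  rewrite -sum1_card natr_sum /h [RHS]big_mkcond [LHS]big_mkcond.
  by apply: eq_bigr => x _; rewrite inE; case: (x \in A) => //; case: ifP.
have -> : \sum_(x in A) g x = c * \sum_(x in A) h x + \sum_(x in A) g2 x.
  by rewrite mulr_sumr -big_split; apply: eq_bigr => x _; rewrite /= /g2; ring.
(* Differences add without cancellation: inside [S] the indicator is constant, and on an edge
   leaving [S] both [g] and [g2] vanish at the outer end. *)
have -> : \sum_(x in A) \sum_i `|g x - g (cflip i x)| =
    c * (\sum_(x in A) \sum_i `|h x - h (cflip i x)|) +
    \sum_(x in A) \sum_i `|g2 x - g2 (cflip i x)|.
  rewrite mulr_sumr -big_split; apply: eq_bigr => x xA /=.
  rewrite mulr_sumr -big_split; apply: eq_bigr => i _ /=.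
  have yA := cflip_in i xA; move: (cflip i x) yA => y yA.
  have := g2_ge0 _ xA; have := g2_ge0 _ yA; rewrite /g2 /h.
  case: (boolP (x \in S)) => xS; case: (boolP (y \in S)) => yS;
    rewrite ?(gS _ xA xS) ?(gS _ yA yS) ?mulr0 ?mulr1 ?subr0 ?sub0r ?subrr
      ?normr0 ?normr1 ?normrN ?mulr0 ?mulr1 ?add0r ?addr0 //.
  - by move=> _ _; congr `|_|; ring.
  - by move=> _ h0; rewrite ger0_norm ?g0 // ger0_norm //; ring.
  - by move=> h0 _; rewrite normr1 mulr1 ger0_norm ?g0 // ger0_norm //; ring.
move: H1 H2; set a := \sum_(x in A) h x; set b := \sum_(x in A) g2 x => H1 H2.
rewrite mulrDr; apply: lerD H2.
by rewrite mulrCA ler_pM2l.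
Qed.

(** * The Poincare inequality *)

Hypotheses (n_gt0 : (0 < n)%N) (A0 : A != set0).

Lemma card_gt0R : 0 < #|A|%:R :> R.
Proof. by rewrite ltr0n card_gt0. Qed.

Lemma unif_prob_gt0 : 0 < p.
Proof. by rewrite /p /unif_prob divr_gt0 ?exprn_gt0 // card_gt0R. Qed.

Lemma unif_prob_le1 : p <= 1.
Proof.
rewrite /p /unif_prob ler_pdivrMr ?exprn_gt0 // mul1r -natrX ler_nat.
by apply: leq_trans (max_card _) _; rewrite card_ffun card_bool card_ord.
Qed.

(** This is 4 n |A| times the Dirichlet form of the chain; each edge is counted from both ends. *)
Definition energy (f : cube n -> R) : R :=
  \sum_(x in A) \sum_i (f x - f (cflip i x)) ^+ 2.

(* Cheeger's argument: the L1 inequality is applied to g^2, and the edge terms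
   |g(x)^2 - g(y)^2| are separated by AM-GM, with the weight chosen so that half of
   the left-hand side absorbs the term in g^2. *)
Lemma poincare_half (g : cube n -> R) :
    (forall x, x \in A -> 0 <= g x) ->
    (2 * #|[set x in A | (0 < g x)%R]| <= #|A|)%N ->
  p ^+ 2 / (16%:R * n%:R) * \sum_(x in A) g x ^+ 2 <= energy g.
Proof.
move=> g0 S2; have p0 := unif_prob_gt0.
have m0 : 0 < n%:R :> R by rewrite ltr0n.
set m : R := n%:R in m0 *; set G := \sum_(x in A) _.
have S2' : (2 * #|[set x in A | (0 < g x ^+ 2)%R]| <= #|A|)%N.
  rewrite (_ : [set x in A | _] = [set x in A | 0 < g x]) //.
  apply/setP => x; rewrite !inE; case: (boolP (x \in A)) => //= xA.
  by rewrite !lt0r sqrf_eq0 sqr_ge0 g0.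
have := L1_isoperimetry (fun x _ => sqr_ge0 (g x)) S2'.
rewrite -/p -/G => H; clearbody p.
have {}H : p / 2%:R * G <= 4%:R * m / p * energy g + p / 4%:R * G.
  apply: le_trans H _.
  (* Each [cflip i] permutes [A], so the double sum equals 2 n G. *)
  have -> : p / 4%:R * G = p / (8%:R * m) *
      \sum_(x in A) \sum_(i < n) (g x ^+ 2 + g (cflip i x) ^+ 2).
    under eq_bigr do rewrite big_split /= sumr_const card_ord -mulr_natl -/m.
    rewrite big_split /= exchange_big /= -mulr_sumr.
    under [X in _ + X]eq_bigr => i _ do
      rewrite (sum_cflip i (fun x => g x ^+ 2)).
    rewrite sumr_const card_ord -mulr_natl -/m -/G.
    by field; rewrite gt_eqF.
  rewrite /energy !mulr_sumr -big_split; apply: ler_sum => x xA /=.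
  rewrite !mulr_sumr -big_split; apply: ler_sum => i _ /=.
  have := g0 _ xA; have := g0 _ (cflip_in i xA).
  move: (g x) (g (cflip i x)) => a b b0 a0.
  rewrite -(@ler_pM2l _ (16%:R * m * p)) ?mulr_gt0 //.
  have -> : 16%:R * m * p * (4%:R * m / p * (a - b) ^+ 2 +
       p / (8%:R * m) * (a ^+ 2 + b ^+ 2)) =
     64%:R * m ^+ 2 * (a - b) ^+ 2 + 2%:R * p ^+ 2 * (a ^+ 2 + b ^+ 2).
    by field; rewrite !gt_eqF.
  rewrite subr_sqr normrM (ger0_norm (addr_ge0 a0 b0)) -(real_normK (num_real (a - b))).
  (* The first square is AM-GM; the second equals p^2 (2 (a^2 + b^2) - (a + b)^2) and removes (a +
     b)^2 from it. *)
  have : 0 <= (8%:R * m * `|a - b| - p * (a + b)) ^+ 2 by apply: sqr_ge0.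
  have : 0 <= p ^+ 2 * (a - b) ^+ 2 by rewrite mulr_ge0 ?sqr_ge0 ?ler0n.
  by nra.
rewrite -(@ler_pM2l _ (4%:R * m / p)) ?divr_gt0 ?mulr_gt0 //.
have -> : 4%:R * m / p * (p ^+ 2 / (16%:R * m) * G) = p / 4%:R * G.
  by field; rewrite !gt_eqF.
lra.
Qed.

(** Take the least attained value [f z] with at most half of [A] strictly above it. If more than
    half lay strictly below, the largest value under [f z] would also have at most half above it,
    against minimality. *)
Lemma median (f : cube n -> R) : exists m,
  (2 * #|[set x in A | (m < f x)%R]| <= #|A|)%N /\
  (2 * #|[set x in A | (f x < m)%R]| <= #|A|)%N.
Proof.
have /set0Pn [x0 x0A] := A0.
case: (@arg_maxP _ _ _ x0 (fun x => x \in A) f x0A) => x1 x1A xmax.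
pose P x := (x \in A) && (2 * #|[set y in A | (f x < f y)%R]| <= #|A|)%N.
have Px1 : P x1.
  rewrite /P x1A (_ : [set y in A | _] = set0) ?cards0 //.
  apply/setP => y; rewrite !inE; apply/negbTE/negP => /andP[yA].
  by rewrite ltNge; have := xmax _ yA; rewrite /= => ->.
case: (@arg_minP _ _ _ x1 P f Px1) => z /andP[zA zP] zmin.
exists (f z); split => //; rewrite leqNgt; apply/negP => big.
have /set0Pn [y0 y0L] : [set x in A | f x < f z] != set0.
  by apply: contraTneq big => ->; rewrite cards0.
case: (@arg_maxP _ _ _ y0 (fun x => x \in [set x in A | f x < f z]) f y0L) => y.
rewrite inE => /andP[yA yz] ymax.
suff /zmin : P y by rewrite /= leNgt yz.
apply/andP; split => //.
have : (#|[set x in A | (f x < f z)%R]| + #|[set x in A | (f y < f x)%R]| <= #|A|)%N.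
  rewrite -leq_subRL ?subset_leq_card //; last first.
    by apply/subsetP => x; rewrite inE => /andP[].
  have sub : [set x in A | f x < f z] \subset A.
    by apply/subsetP => x; rewrite inE => /andP[].
  rewrite -{1}(setIidPr sub) -cardsD; apply/subset_leq_card/subsetP => x.
  rewrite !inE => /andP[xA yx]; rewrite xA andbT /= -leNgt leNgt.
  apply/negP => xz; have := ymax x; rewrite inE xA xz /= => /(_ isT).
  by rewrite leNgt yx.
by move: big; lia.
Qed.

(** The positive and negative parts of [f] around a median each live on at most half of [A], so the
    half-support inequality applies to both. *)
Lemma poincare (f : cube n -> R) : \sum_(x in A) f x = 0 ->
  p ^+ 2 / (16%:R * n%:R) * \sum_(x in A) f x ^+ 2 <= energy f.
Proof.
move=> f0; have [m [hi lo]] := median f.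
pose u x := Num.max (f x - m) 0; pose v x := Num.max (m - f x) 0.
have u0 x : x \in A -> 0 <= u x by rewrite le_max lexx orbT.
have v0 x : x \in A -> 0 <= v x by rewrite le_max lexx orbT.
have Hu : (2 * #|[set x in A | (0 < u x)%R]| <= #|A|)%N.
  rewrite (_ : [set x in A | _] = [set x in A | m < f x]) //.
  by apply/setP => x; rewrite !inE lt_max ltxx orbF subr_gt0.
have Hv : (2 * #|[set x in A | (0 < v x)%R]| <= #|A|)%N.
  rewrite (_ : [set x in A | _] = [set x in A | f x < m]) //.
  by apply/setP => x; rewrite !inE lt_max ltxx orbF subr_gt0.
have K0 : 0 <= p ^+ 2 / (16%:R * n%:R) by rewrite divr_ge0 ?sqr_ge0 ?mulr_ge0 ?ler0n.
apply: (@le_trans _ _ (energy u + energy v)).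
  apply: le_trans (lerD (poincare_half u0 Hu) (poincare_half v0 Hv)).
  rewrite -mulrDr; apply: (ler_wpM2l K0).
  (* As [f] has mean zero, its second moment about [m] exceeds the one about 0 by m^2 per point. *)
  have -> : \sum_(x in A) f x ^+ 2 =
      \sum_(x in A) (f x - m) ^+ 2 - #|A|%:R * m ^+ 2.
    apply/eqP; rewrite eq_sym subr_eq; apply/eqP.
    under eq_bigr do rewrite sqrrB.
    rewrite !big_split /= sumr_const sumrN sumrMnl -mulr_suml f0 mul0r mul0rn.
    by rewrite oppr0 addr0 mulr_natl.
  rewrite lerBlDr; apply: ler_wpDr; first by rewrite mulr_ge0 ?sqr_ge0 ?ler0n.
  rewrite -big_split; apply: ler_sum => x _; rewrite /= /u /v.
  by rewrite !maxEle; do 2 case: ifP; nra.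
rewrite /energy -big_split; apply: ler_sum => x _ /=.
rewrite -big_split; apply: ler_sum => i _ /=; rewrite /u /v.
move: (f x) (f (cflip i x)) => a b.
have below c : c <= m -> (Num.max (c - m) 0 = 0) * (Num.max (m - c) 0 = m - c).
  by move=> cm; rewrite max_r ?max_l ?subr_le0 ?subr_ge0.
have above c : m < c -> (Num.max (c - m) 0 = c - m) * (Num.max (m - c) 0 = 0).
  by move=> /ltW mc; rewrite max_l ?max_r ?subr_le0 ?subr_ge0.
(* On an edge across the median, |a - b| is the sum of the two distances to [m], and its square
   dominates the sum of their squares. *)
have [am|ma] := leP a m; have [bm|mb] := leP b m.
- by rewrite !below //; nra.
- have : 0 <= (m - a) * (b - m) by rewrite mulr_ge0 // subr_ge0 // ltW.
  by rewrite !(below a) // !(above b) //; nra.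
- have : 0 <= (a - m) * (m - b) by rewrite mulr_ge0 // subr_ge0 // ltW.
  by rewrite !(below b) // !(above a) //; nra.
- by rewrite !above //; nra.
Qed.

(** * Contraction of the squared norm in one step *)

Lemma sqr_sum_le m (a : 'I_m -> R) :
  (\sum_i a i) ^+ 2 <= m%:R * \sum_i a i ^+ 2.
Proof.
case: m a => [|m] a; first by rewrite !big_ord0 mulr0 expr0n.
set s := \sum_i a i; set N : R := m.+1%:R; set Q := \sum_i _.
have N0 : 0 < N by rewrite ltr0n.
(* Cauchy-Schwarz against the constant 1, read off from a nonnegative variance. *)
have : 0 <= \sum_i (N * a i - s) ^+ 2 by apply: sumr_ge0 => i _; apply: sqr_ge0.
have -> : \sum_i (N * a i - s) ^+ 2 = N * (N * Q - s ^+ 2).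
  under eq_bigr do rewrite sqrrB exprMn.
  rewrite !big_split /= sumr_const card_ord sumrN sumrMnl -mulr_suml -!mulr_sumr.
  by rewrite -/s -/Q -mulr_natl -/N; ring.
by rewrite pmulr_rge0 // subr_ge0.
Qed.

(** The left action of the transition matrix on mass functions, written over the cube so that
    [cflip] applies without the enumeration of [A]. *)
Definition evolve (f : cube n -> R) (y : cube n) : R :=
  \sum_(x in A) f x * step_prob R A x y.

(** The only preimage of [y] in [A] under the involution [cflip i] is [cflip i y]; hence mass
    evolves by averaging. *)
Lemma evolveE f y : y \in A ->
  evolve f y = n%:R^-1 * \sum_i 2%:R^-1 * (f y + f (cflip i y)).
Proof.
move=> yA; rewrite /evolve.
transitivity (n%:R^-1 * \sum_(x in A) \sum_i
    2%:R^-1 * (f x * (x == y)%:R + f x * (cflip i x == y)%:R)).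
  rewrite mulr_sumr; apply: eq_bigr => x xA.
  rewrite step_probE // mulrCA; congr (_ * _); rewrite mulr_sumr.
  by apply: eq_bigr => i _; rewrite mulrCA mulrDr.
rewrite exchange_big /=; congr (_ * _); apply: eq_bigr => i _.
rewrite -mulr_sumr big_split /=; congr (_ * (_ + _)).
  rewrite (bigD1 y) //= eqxx mulr1 big1 ?addr0 // => x /andP[_ /negbTE ->].
  by rewrite mulr0.
have yA' := cflip_in i yA.
rewrite (bigD1 (cflip i y)) //= cflipK // eqxx mulr1 big1 ?addr0 //.
move=> x /andP[xA xy]; case: eqP => [E|]; last by rewrite mulr0.
by rewrite -E cflipK // eqxx in xy.
Qed.

Lemma sum_evolve f : \sum_(y in A) evolve f y = \sum_(y in A) f y.
Proof.
have n0 : n%:R != 0 :> R by rewrite pnatr_eq0 -lt0n.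
rewrite (eq_bigr _ (fun y yA => evolveE f yA)) -mulr_sumr exchange_big /=.
under eq_bigr => i _.
  rewrite -mulr_sumr big_split /= (sum_cflip i f).
  over.
by rewrite sumr_const card_ord -mulr_natl; field.
Qed.

(** The Poincare constant p^2 / (16 n) divided by 4 n, where 1/4 comes from the parallelogram
    identity and 1/n from the choice of coordinate. *)
Definition gap : R := p ^+ 2 / (64%:R * n%:R ^+ 2).

(* By the parallelogram identity, the update f |-> (f + f o cflip i) / 2 lowers
   the squared norm by a quarter of the energy in direction i. *)
Lemma evolve_contract f : \sum_(y in A) f y = 0 ->
  \sum_(y in A) evolve f y ^+ 2 <= (1 - gap) * \sum_(y in A) f y ^+ 2.
Proof.
move=> f0; have m0 : 0 < n%:R :> R by rewrite ltr0n.
have := poincare f0; rewrite -/p; set F := \sum_(y in A) f y ^+ 2.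
move=> P.
apply: (@le_trans _ _ (F - (4%:R * n%:R)^-1 * energy f)); last first.
  rewrite mulrBl mul1r lerD2l lerN2.
  rewrite -(@ler_pM2l _ (4%:R * n%:R)) ?mulr_gt0 // mulVKf ?mulf_neq0 ?gt_eqF //.
  apply: le_trans P; rewrite le_eqVlt; apply/orP; left; apply/eqP.
  by rewrite /gap; field; rewrite gt_eqF.
(* Convexity: the square of the average over coordinates is at most the average of the squares. *)
apply: (@le_trans _ _ (\sum_(y in A) n%:R^-1 *
    \sum_i (2%:R^-1 * (f y + f (cflip i y))) ^+ 2)).
  apply: ler_sum => y yA; rewrite evolveE // exprMn expr2 -mulrA.
  rewrite ler_pM2l ?invr_gt0 // -(@ler_pM2l _ n%:R) // mulVKf ?gt_eqF //.
  exact: sqr_sum_le.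
rewrite le_eqVlt; apply/orP; left; apply/eqP.
(* Invariance of the sum under [cflip i] spreads [F] over both ends of each edge, so the identity
   can be checked edge by edge. *)
have -> : F = (2%:R * n%:R)^-1 *
    \sum_(y in A) \sum_i (f y ^+ 2 + f (cflip i y) ^+ 2).
  under eq_bigr do rewrite big_split /= sumr_const card_ord -mulr_natl.
  rewrite big_split /= exchange_big /= -mulr_sumr.
  under [X in _ + X]eq_bigr => i _ do
    rewrite (sum_cflip i (fun x => f x ^+ 2)).
  rewrite sumr_const card_ord -mulr_natl -/F.
  by field; rewrite gt_eqF.
rewrite /energy !mulr_sumr -sumrB; apply: eq_bigr => y _.
rewrite !mulr_sumr -sumrB; apply: eq_bigr => i _.
by field; rewrite gt_eqF.
Qed.

(** * Row vectors as functions, and the L2 distance after t steps *)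

Notation P := (trans_mx R A).
Notation pi := (unif_dist R A).

(** The sum has at most one term; this form gives the value 0 outside [A] and asks for no membership
    proof. *)
Definition density (v : 'rV[R]_#|A|) (x : cube n) : R :=
  \sum_(i | enum_val i == x) v 0 i.

Lemma density_enum_val v i : density v (enum_val i) = v 0 i.
Proof.
rewrite /density (bigD1 i) //= big1 ?addr0 // => j /andP[/eqP/enum_val_inj ->].
by rewrite eqxx.
Qed.

Lemma sum_density (F : R -> R) v :
  \sum_(x in A) F (density v x) = \sum_i F (v 0 i).
Proof.
by rewrite [LHS]big_enum_val; apply: eq_bigr => i _; rewrite density_enum_val.
Qed.

Lemma mulmx_trans v j : (v *m P) 0 j = evolve (density v) (enum_val j).
Proof.
rewrite mxE /evolve [RHS]big_enum_val /=; apply: eq_bigr => i _.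
by rewrite density_enum_val mxE.
Qed.

Lemma unif_dist_stationary : pi *m P = pi.
Proof.
have n0 : n%:R != 0 :> R by rewrite pnatr_eq0 -lt0n.
have E (x : cube n) : x \in A -> density pi x = #|A|%:R^-1.
  by move=> xA; rewrite -(enum_rankK_in xA xA) density_enum_val mxE.
apply/rowP => j; rewrite mulmx_trans evolveE ?enum_valP //.
under eq_bigr do rewrite !E ?cflip_in ?enum_valP //.
rewrite sumr_const card_ord -mulr_natl mxE; field; rewrite n0 /=.
by rewrite pnatr_eq0 -lt0n card_gt0 A0.
Qed.

Lemma gap_le1 : gap <= 1.
Proof.
have m1 : 1 <= n%:R :> R by rewrite ler1n.
have p1 : p <= 1 := unif_prob_le1; have p0 : 0 < p := unif_prob_gt0.
rewrite /gap ler_pdivrMr ?mulr_gt0 ?exprn_gt0 ?ltr0n // mul1r.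
by apply: (@le_trans _ _ 1); nra.
Qed.

(** Stationarity lets the difference to [pi] evolve by [P], so each step contracts it. A point mass
    starts at squared distance 1 - 1/|A|. *)
Lemma sqr_dist_le i t :
  \sum_j ((row i (P ^+ t) - pi) 0 j) ^+ 2 <= (1 - gap) ^+ t.
Proof.
have a0 := card_gt0R.
have cA : \sum_(j < #|A|) #|A|%:R^-1 = 1 :> R.
  by rewrite sumr_const card_ord -[LHS]mulr_natl divff ?gt_eqF.
(* The contraction holds for functions of sum zero, so this property joins the induction. *)
suff [_ //] : \sum_j (row i (P ^+ t) - pi) 0 j = 0 /\
  \sum_j ((row i (P ^+ t) - pi) 0 j) ^+ 2 <= (1 - gap) ^+ t.
elim: t => [|t [IH0 IH]].
  have E j : (row i (P ^+ 0) - pi) 0 j = (i == j)%:R - #|A|%:R^-1.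
    by rewrite expr0 !mxE.
  have d1 : \sum_(j < #|A|) (i == j)%:R = 1 :> R.
    by rewrite (bigD1 i) //= eqxx big1 ?addr0 // => j; rewrite eq_sym => /negbTE ->.
  split; first by under eq_bigr do rewrite E; rewrite sumrB d1 cA subrr.
  under eq_bigr do rewrite E.
  rewrite expr0 (_ : \sum_j _ = 1 - #|A|%:R^-1).
    by rewrite gerBl invr_ge0 ltW.
  have -> : \sum_j ((i == j)%:R - #|A|%:R^-1 : R) ^+ 2 =
    \sum_j ((i == j)%:R - 2%:R * #|A|%:R^-1 * (i == j)%:R
             + #|A|%:R^-1 * #|A|%:R^-1).
    by apply: eq_bigr => j _; case: (i == j) => /=; ring.
  rewrite big_split sumrB /= -!mulr_sumr d1 cA.
  by ring.
have E : row i (P ^+ t.+1) - pi = (row i (P ^+ t) - pi) *m P.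
  by rewrite mulmxBl unif_dist_stationary exprSr -row_mul.
rewrite E; move: (row i _ - _) IH0 IH => v v0 vt.
have d0 : \sum_(y in A) density v y = 0 by rewrite (sum_density id).
split.
  under eq_bigr do rewrite mulmx_trans.
  by rewrite -(big_enum_val (evolve (density v))) sum_evolve.
under eq_bigr do rewrite mulmx_trans.
rewrite -(big_enum_val (fun y => evolve (density v) y ^+ 2)).
apply: le_trans (evolve_contract d0) _.
rewrite (sum_density (fun r => r ^+ 2)) exprS.
by apply: ler_wpM2l vt; rewrite subr_ge0 gap_le1.
Qed.

(** * From L2 decay to the mixing time *)

Lemma worst_tv_le t :
  4%:R * #|A|%:R * (1 - gap) ^+ t <= 1 -> worst_tv R A t <= 4%:R^-1.
Proof.
move=> small; apply: bigmax_le => [|i _]; first by rewrite invr_ge0.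
rewrite /tv_dist; set s := \sum_j _.
have s0 : 0 <= s by apply: sumr_ge0.
(* Cauchy-Schwarz bounds the squared L1 distance, which is thus at most 1/4; then s <= 1/2, and
   total variation is half of [s]. *)
have : s ^+ 2 <= #|A|%:R * (1 - gap) ^+ t.
  apply: le_trans (sqr_sum_le _) _; rewrite ler_pM2l ?card_gt0R //.
  apply: le_trans (sqr_dist_le i t); apply: ler_sum => j _.
  by rewrite real_normK ?num_real // !mxE.
by nra.
Qed.

(** The integer part of [B] serves as the time. For B >= 1 it is at least B / 2, so a hypothesis
    stated with B / 2 survives the rounding. *)
Lemma mixing_time_bound (B : R) : 1 <= B -> ln (4%:R * #|A|%:R) / gap <= B / 2%:R ->
  exists tau, is_mixing_time R A tau /\ tau%:R <= B.
Proof.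
move=> B1 LB.
have a0 := card_gt0R.
have g0 : 0 < gap.
  by rewrite /gap divr_gt0 ?exprn_gt0 ?unif_prob_gt0 // mulr_gt0 ?exprn_gt0 ?ltr0n.
have B0 : 0 <= B by lra.
have [t tB Bt] : exists2 t : nat, t%:R <= B & B < t.+1%:R.
  by have /andP[lo hi] := truncn_itv B0; exists (Num.truncn B).
have tmix : worst_tv R A t <= 4%:R^-1.
  apply: worst_tv_le.
  have t2 : B / 2%:R <= t%:R.
    have t1 : 1 <= t%:R :> R.
      by rewrite ler1n; case: t Bt {tB} => //; rewrite ltNge B1.
    by move: Bt; rewrite -natr1; lra.
  have Lt : ln (4%:R * #|A|%:R) <= gap * t%:R.
    by rewrite [leRHS]mulrC -ler_pdivrMr //; apply: le_trans LB t2.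
  (* This is 1 - gap <= exp(-gap), raised to the power [t]. *)
  have le_exp : (1 - gap) ^+ t <= expR (- (gap * t%:R)).
    rewrite -[- (gap * _)]mulNr expRM_natr; apply: lerXn2r.
    - by rewrite nnegrE subr_ge0 gap_le1.
    - by rewrite nnegrE expR_ge0.
    - exact: expR_ge1Dx.
  rewrite -[4%:R * _]lnK ?posrE ?mulr_gt0 //.
  apply: (@le_trans _ _ (expR (gap * t%:R) * expR (- (gap * t%:R)))).
    by apply: ler_pM; rewrite ?expR_ge0 ?exprn_ge0 ?subr_ge0 ?gap_le1 ?ler_expR.
  by rewrite -expRD subrr expR0.
have ex : exists t, worst_tv R A t <= 4%:R^-1 by exists t.
case: (ex_minnP ex) => tau tau_mix tau_min; exists tau; split; first by split.
by apply: le_trans tB; rewrite ler_nat; apply: tau_min.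
Qed.

End CensoredWalk.

(** * The explicit constants *)

Theorem corollary1p2 (R : realType) (n : nat) (hn : (1 <= n)%N)
    (A : {set cube n}) (hA : A != set0) (hmon : monotone_set A) :
  exists tau : nat, is_mixing_time R A tau /\
    tau%:R <= 2%:R * (16%:R * n%:R / unif_prob R A) ^+ 2
              * ln (4%:R * 2%:R ^+ n * unif_prob R A).
Proof.
have -> : 4%:R * 2%:R ^+ n * unif_prob R A = 4%:R * #|A|%:R.
  by rewrite /unif_prob -mulrA [_ ^+ n * _]mulrC divfK ?expf_neq0 ?pnatr_eq0.
have p0 := unif_prob_gt0 R hA; have p1 := unif_prob_le1 R A.
have n1 : 1 <= n%:R :> R by rewrite ler1n.
have a1 : 1 <= #|A|%:R :> R by rewrite ler1n card_gt0.
(* From ln(1 + x) <= x at x = 1/(4|A|) - 1, which even gives 3/4. This bound makes the claimed time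
   at least 1. *)
have L : 1 / 2%:R <= ln (4%:R * #|A|%:R) :> R.
  have := @le_ln1Dx R ((4%:R * #|A|%:R)^-1 - 1).
  have i0 : 0 < (4%:R * #|A|%:R)^-1 :> R by rewrite invr_gt0; lra.
  have i1 : (4%:R * #|A|%:R)^-1 <= 4%:R^-1 :> R by rewrite lef_pV2 ?posrE; lra.
  by rewrite [1 + _]addrC subrK lnV ?posrE => [/(_ ltac:(lra))|]; lra.
have q : 1 <= n%:R / unif_prob R A by rewrite ler_pdivlMr // mul1r; apply: le_trans n1.
have q2 : 1 <= (n%:R / unif_prob R A) ^+ 2 by rewrite exprn_ege1.
have E : (16%:R * n%:R / unif_prob R A) ^+ 2 = 256%:R * (n%:R / unif_prob R A) ^+ 2.
  by field; rewrite gt_eqF.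
(* Half of the claimed bound has 256 in place of 64, so a factor 4 is to spare. *)
have G : ln (4%:R * #|A|%:R) / gap R A =
    64%:R * (n%:R / unif_prob R A) ^+ 2 * ln (4%:R * #|A|%:R).
  by rewrite /gap; field; rewrite !gt_eqF //; lra.
by apply: mixing_time_bound => //; rewrite ?G E; nra.
Qed.
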